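(* For every integer $t$ with $2 \le t \le 5$ and every integer $s > 1$, $R^k(s,t) = (s-1)(t-1)+1$.
   Context: All graphs are finite, simple and undirected; $A_G$ is the adjacency matrix of $G$, $I$ the identity matrix, rank is over $\mathbb{R}$, $\omega(G)$ is the clique number. The Rank-Ramsey number $R^k(s,t)$ is the smallest integer $N$ such that every graph $G$ on $N$ vertices satisfies $\omega(G)\ge s$ or $\operatorname{rank}(A_G+I)\ge t$. *)

(* Defs.v *)
From mathcomp Require Import all_boot all_order all_algebra.
From mathcomp Require Import reals.

Set Implicit Arguments.
Unset Strict Implicit.
Unset Printing Implicit Defensive.

Record sgraph (n : nat) := SGraph {
  adj : rel 'I_n;
  adj_sym : symmetric adj;
  adj_irr : irreflexive adj
}.

Definition clique (n : nat) (G : sgraph n) (S : {set 'I_n}) : bool :=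
  [forall x in S, forall y in S, (x != y) ==> adj G x y].

Definition clique_number (n : nat) (G : sgraph n) : nat :=
  \max_(S : {set 'I_n} | clique G S) #|S|.

Definition adjmx (R : realType) (n : nat) (G : sgraph n) : 'M[R]_n :=
  (\matrix_(i, j) (adj G i j)%:R)%R.

Definition rank_ramsey_prop (R : realType) (s t N : nat) : Prop :=
  forall G : sgraph N,
    s <= clique_number G \/ t <= \rank (adjmx R G + 1%:M)%R.

(* "R^k(s,t) = N".  The property is not assumed monotone in N, so minimality
   is stated against every M that has it. *)
Definition is_rank_ramsey_number (R : realType) (s t N : nat) : Prop :=
  rank_ramsey_prop R s t N /\
  forall M : nat, rank_ramsey_prop R s t M -> N <= M.

(* Main.v *)
(** If M = A_G + I has rank r, some r vertices span a nonsingular principal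
   submatrix of M (the base), and the vanishing of the (r+1)-minors containing
   it shows that the adjacency of two vertices is determined by their profiles,
   that is, by their rows restricted to the base.  For r <= 4 there are finitely
   many bases and profiles, and an exhaustive check shows that for each base the
   possible profiles are covered by r classes of pairwise adjacent profiles.
   Hence G is covered by r cliques and has at most r * omega(G) vertices.
   A disjoint union of t - 1 cliques of size s - 1 shows that this is sharp. *)
Require Import Defs.
From mathcomp Require Import all_boot all_order all_algebra.
From mathcomp Require Import reals.

Set Implicit Arguments.
Unset Strict Implicit.
Unset Printing Implicit Defensive.

Import GRing.Theory Num.Theory.

(** * Computable determinants and the finite check of bases and profiles *)

Fixpoint bmx_det (n : nat) (f : nat -> nat -> bool) : int :=
  if n is n'.+1 then
    foldr (fun j d => ((if f 0 j then bmx_det n' (fun a c => f a.+1 (bump j c))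
                        else 0) - d)%R) 0%R (iota 0 n)
  else 1%R.

Fixpoint bitseqs (k : nat) : seq bitseq :=
  if k is k'.+1 then
    [seq true :: p | p <- bitseqs k'] ++ [seq false :: p | p <- bitseqs k']
  else [:: [::]].

(* The 0/1 symmetric matrix with unit diagonal whose entries above the diagonal
   are listed column by column in b. *)
Definition base_mx (b : bitseq) (i j : nat) : bool :=
  (i == j) || nth false b ('C(maxn i j, 2) + minn i j).

Definition bordered_mx (r : nat) (b p q : bitseq) (e : bool) (i j : nat) :=
  if i < r then if j < r then base_mx b i j else nth false q i
  else if j < r then nth false p j else e.

(** The bordered determinant is affine in its corner entry, with slope the determinant of the base.
    For a nonsingular base at most one corner value makes it vanish; this tests the value 0. *)
Definition nonadj r b p q := bmx_det r.+1 (bordered_mx r b p q false) == 0%R.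

(** Greedy first-fit colouring; its output is certified afterwards by [cover_ok]. *)
Fixpoint insert_block r b p (B : seq (seq bitseq)) : seq (seq bitseq) :=
  if B is c :: B' then
    if has (nonadj r b p) c then c :: insert_block r b p B' else (p :: c) :: B'
  else [:: [:: p]].

(** The bordered minor with both new indices at one vertex has corner 1, the diagonal entry of A_G +
    I. *)
Definition profiles r b :=
  [seq p <- bitseqs r | bmx_det r.+1 (bordered_mx r b p p true) == 0%R].

Definition blocks r b := foldr (insert_block r b) [::] (profiles r b).

Definition cover_ok r b :=
  [&& size (blocks r b) <= r,
      all (fun p => has (fun c => p \in c) (blocks r b)) (profiles r b) &
      all (fun c => all (fun p => all (fun q => ~~ nonadj r b p q) c) c)
        (blocks r b)].

(** 6 = C(4,2) bits encode a base of size 4; a smaller base reads only an initial segment of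
    them. *)
Definition cover_check r :=
  all (fun b => (bmx_det r (base_mx b) == 0%R) || cover_ok r b) (bitseqs 6).

Lemma cover_checkT r : r < 5 -> cover_check r.
Proof.
have /allP chk : all cover_check (iota 0 5) by vm_compute.
by move=> lt_r5; apply: chk; rewrite mem_iota.
Qed.

Lemma mem_bitseqs (p : bitseq) : p \in bitseqs (size p).
Proof.
elim: p => //= b p IHp; rewrite mem_cat.
by apply/orP; case: b; [left | right]; apply/mapP; exists p.
Qed.

(** Nested differences a_0 - (a_1 - (a_2 - ...)) produce the alternating signs of the Laplace
    expansion. *)
Lemma foldr_sub_iota (a : nat -> int) k n :
  foldr (fun j d => a j - d)%R 0%R (iota k n) =
  (\sum_(j < n) (-1) ^+ j * a (k + j)%N)%R.
Proof.
elim: n k => [|n IHn] k; first by rewrite big_ord0.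
rewrite big_ord_recl /= IHn addn0 expr0 mul1r -sumrN; congr (_ + _)%R.
by apply: eq_bigr => j _; rewrite exprS mulN1r mulNr /bump /= add1n addSnnS.
Qed.

Lemma det_bmx (R : comPzRingType) n (f : nat -> nat -> bool) :
  (\det (\matrix_(i < n, j < n) (f i j)%:R) = (bmx_det n f)%:~R :> R)%R.
Proof.
elim: n f => [|n IHn] f; first by rewrite det_mx00.
have -> : bmx_det n.+1 f = (\sum_(j < n.+1) (-1) ^+ j *
    if f 0 j then bmx_det n (fun a c => f a.+1 (bump j c)) else 0)%R.
  exact: (foldr_sub_iota
    (fun j => if f 0 j then bmx_det n (fun a c => f a.+1 (bump j c)) else 0%R)).
rewrite (expand_det_row _ ord0) raddf_sum; apply: eq_bigr => j _ /=.
rewrite mxE /=; case: (f 0 j); last by rewrite mul0r mulr0.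
rewrite mul1r /cofactor add0n intrM rmorphXn rmorphN1 /= -IHn; congr (_ * \det _)%R.
by apply/matrixP => a c; rewrite !mxE.
Qed.

(** * Rank and minors *)

Lemma principal_submx_unit (F : fieldType) n (A : 'M[F]_n) :
  (A^T = A)%R ->
  exists f : 'I_(\rank A) -> 'I_n, mxsub f f A \in unitmx.
Proof.
move=> symA; exists (maxrankfun A); set f := maxrankfun A.
have /submxP[B defA] : (A <= rowsub f A)%MS by rewrite eq_maxrowsub.
have defAc : A = (colsub f A *m B^T)%R.
  by rewrite -[LHS]symA {1}defA trmx_mul trmx_mxsub symA.
(* Writing P for the selected principal block, A = B P B^T gives rank A <= rank P, so P has full
   rank. *)
have defA' : A = (B *m mxsub f f A *m B^T)%R.
  by rewrite -mulmxA [mxsub f f A]mxsubrc mul_rowsub_mx -defAc.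
rewrite -row_free_unit -row_leq_rank.
apply: leq_trans (eq_leq (congr1 (@mxrank F n n) defA')) _.
exact: leq_trans (mxrankM_maxl _ _) (mxrankM_maxr _ _).
Qed.

Lemma det_mxsub_eq0 (F : fieldType) m n k (A : 'M[F]_(m, n))
    (f : 'I_k -> 'I_m) (g : 'I_k -> 'I_n) :
  \rank A < k -> (\det (mxsub f g A) = 0)%R.
Proof.
move=> rkA; apply/eqP/negPn; rewrite -unitfE -unitmxE -row_free_unit.
rewrite -row_leq_rank -ltnNge; apply: leq_ltn_trans rkA.
rewrite mxsubcr -mxrank_tr trmx_mxsub.
apply: leq_trans (mxrankS (rowsub_sub _ _)) _.
by rewrite mxrank_tr mxrankS ?rowsub_sub.
Qed.

(** * Clique covers from small rank *)

Definition cadj n (G : sgraph n) (x y : 'I_n) : bool := (x == y) || adj G x y.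

Lemma cadj_sym n (G : sgraph n) x y : cadj G x y = cadj G y x.
Proof. by rewrite /cadj eq_sym adj_sym. Qed.

Lemma adjmxD1E (R : realType) n (G : sgraph n) :
  (adjmx R G + 1%:M = \matrix_(i, j) (cadj G i j)%:R)%R.
Proof.
apply/matrixP => i j; rewrite !mxE /cadj; case: eqVneq => [->|_] /=.
  by rewrite adj_irr add0r.
by rewrite addr0.
Qed.

Definition base_bits (m : nat -> nat -> bool) : bitseq :=
  [:: m 0 1; m 0 2; m 1 2; m 0 3; m 1 3; m 2 3].

Lemma base_mx_bits (m : nat -> nat -> bool) i j :
  (forall a, m a a) -> (forall a c, m a c = m c a) -> i < 4 -> j < 4 ->
  base_mx (base_bits m) i j = m i j.
Proof.
move=> m_refl m_sym.
by do 4?[case: i => [|i]] => //; do 4?[case: j => [|j]] => // _ _;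
   rewrite /base_mx /= ?m_refl // m_sym.
Qed.

Lemma rank_clique_cover (R : realType) n (G : sgraph n) :
  let r := (\rank (adjmx R G + 1%:M)%R) in
  r < 5 ->
  exists col : 'I_n -> nat, (forall x, col x < r) /\
    (forall x y, col x = col y -> cadj G x y).
Proof.
rewrite /= adjmxD1E; set A := (\matrix_(i, j) _)%R; set r := \rank A => lt_r5.
case: (posnP n) => [n0 | n_gt0].
  by exists (fun=> 0); split=> -[x ltx]; exfalso; rewrite n0 in ltx.
have symA : (A^T = A)%R by apply/matrixP => i j; rewrite !mxE cadj_sym.
have [f unit_f] := principal_submx_unit symA.
(* Base vertices indexed by [nat]; indices from r on get a dummy vertex, whose bits are never
   read. *)
pose v i : 'I_n := oapp f (Ordinal n_gt0) (insub i).
have vE (i : 'I_r) : v i = f i by rewrite /v insubT //= => ?; congr f; apply: val_inj.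
pose m i j := cadj G (v i) (v j); pose b := base_bits m.
have bE i j : i < r -> j < r -> base_mx b i j = m i j.
  move=> lti ltj; apply: base_mx_bits; rewrite ?(leq_trans lti) ?(leq_trans ltj) //.
    by move=> a; rewrite /m /cadj eqxx.
  by move=> a c; apply: cadj_sym.
have det_b : bmx_det r (base_mx b) != 0%R.
  apply: contraL unit_f => /eqP det0; rewrite unitmxE unitfE negbK.
  suff -> : mxsub f f A = (\matrix_(i, j) (base_mx b i j)%:R)%R.
    by rewrite det_bmx det0.
  by apply/matrixP => i j; rewrite !mxE bE // /m !vE.
pose prof x := mkseq (fun j => cadj G x (v j)) r.
(* Rows base + x and columns base + y form an (r+1)-minor of a rank r matrix. Repeated vertices are
   allowed, so x = y is covered too. *)
have minor0 x y :
    bmx_det r.+1 (bordered_mx r b (prof x) (prof y) (cadj G x y)) == 0%R.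
  pose g z (i : 'I_r.+1) : 'I_n := if i < r then v i else z.
  have := det_mxsub_eq0 (g x) (g y) (ltnSn r : \rank A < r.+1).
  set E := mxsub _ _ _ => detE; rewrite -(intr_eq0 R) -det_bmx -detE.
  apply/eqP; congr (\det _)%R; apply/matrixP => i j; rewrite !mxE /bordered_mx /g.
  case: ltnP => lti; case: ltnP => ltj; rewrite ?bE ?nth_mkseq //.
  by rewrite cadj_sym.
have profP x : prof x \in profiles r b.
  rewrite mem_filter; have := mem_bitseqs (prof x); rewrite size_mkseq => ->.
  by have := minor0 x x; rewrite [cadj G x x]/cadj eqxx andbT.
have /allP/(_ b) := cover_checkT lt_r5.
have b_in : b \in bitseqs 6 by apply: (mem_bitseqs b).
move=> /(_ b_in); rewrite (negbTE det_b) /= => /and3P[szB /allP coverB /allP cliqB].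
pose blk x (c : seq bitseq) := prof x \in c.
have blkP x : has (blk x) (blocks r b) by apply: coverB (profP x).
(* The colour of a vertex is the index of the first block containing its profile. *)
exists (fun x => find (blk x) (blocks r b)); split=> [x | x y eqxy].
  by apply: leq_trans szB; rewrite -has_find.
have x_in := nth_find [::] (blkP x); have y_in := nth_find [::] (blkP y).
rewrite -eqxy in y_in.
have /cliqB/allP/(_ _ x_in)/allP/(_ _ y_in) :
    nth [::] (blocks r b) (find (blk x) (blocks r b)) \in blocks r b.
  by rewrite mem_nth // -has_find.
(* If x and y were distinct and nonadjacent, [minor0] would make their profiles [nonadj], which is
   excluded within a block. *)
rewrite /nonadj; have := minor0 x y; case: (cadj G x y) => // ->.
by [].
Qed.

Lemma leq_clique_number n (G : sgraph n) (S : {set 'I_n}) :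
  clique G S -> #|S| <= clique_number G.
Proof. exact: (@leq_bigmax_cond _ (clique G) (fun S => #|S|)). Qed.

Lemma card_le_clique_cover n (G : sgraph n) r (col : 'I_n -> nat) :
  (forall x, col x < r) -> (forall x y, col x = col y -> cadj G x y) ->
  n <= r * clique_number G.
Proof.
move=> col_lt col_adj; pose c x := Ordinal (col_lt x).
rewrite -{1}[n]card_ord -sum1_card (partition_big c xpredT) //=.
rewrite -[X in X * _]card_ord -sum_nat_const; apply: leq_sum => k _.
rewrite sum1_card -[X in X <= _]cardsE; apply: leq_clique_number.
apply/forall_inP => x; rewrite inE => /eqP cx.
apply/forall_inP => y; rewrite inE => /eqP cy.
apply/implyP => neq_xy.
have := col_adj x y; rewrite /cadj (negbTE neq_xy) /=; apply.
exact: etrans cx (esym cy).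
Qed.

(** * Disjoint cliques for the lower bound *)

Section DisjointCliques.

Variables (k n : nat).

(** Runs of k consecutive vertices form the cliques, the last possibly shorter, so every order n is
    available. *)
Definition dcliques_adj : rel 'I_n := fun x y => (x != y) && (x %/ k == y %/ k).

Lemma dcliques_sym : symmetric dcliques_adj.
Proof. by move=> x y; rewrite /dcliques_adj eq_sym [_ %/ _ == _]eq_sym. Qed.

Lemma dcliques_irr : irreflexive dcliques_adj.
Proof. by move=> x; rewrite /dcliques_adj eqxx. Qed.

Definition dcliques : sgraph n := SGraph dcliques_sym dcliques_irr.

Lemma clique_number_dcliques : 0 < k -> clique_number dcliques <= k.
Proof.
move=> k_gt0; apply/bigmax_leqP => S clS.
(* Vertices of a clique share their quotient by k, so their residues are distinct. *)
pose h (x : 'I_n) := Ordinal (ltn_pmod x k_gt0).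
rewrite -[X in _ <= X]card_ord -(card_in_imset (f := h)) ?max_card // => x y Sx Sy.
move=> /(congr1 val) /= eq_mod; apply: contraTeq isT => neq_xy.
have /forall_inP/(_ x Sx)/forall_inP/(_ y Sy) := clS.
rewrite neq_xy /= /dcliques_adj neq_xy /= => /eqP eq_div.
by case/eqP: neq_xy; apply: val_inj; rewrite /= (divn_eq x k) eq_div eq_mod -divn_eq.
Qed.

Lemma rank_dcliques (R : realType) r :
  n <= r * k -> \rank (adjmx R dcliques + 1%:M)%R <= r.
Proof.
(* B is the incidence matrix of vertices against cliques, and A_G + I = B B^T. *)
move=> le_n; pose B := (\matrix_(x < n, q < r) (x %/ k == q)%N%:R : 'M[R]_(n, r))%R.
suff -> : (adjmx R dcliques + 1%:M = B *m B^T)%R.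
  exact: leq_trans (mxrankM_maxl _ _) (rank_leq_col _).
rewrite adjmxD1E; apply/matrixP => x y; rewrite !mxE.
have ltx : x %/ k < r.
  have [k0|k_gt0] := posnP k; last by rewrite ltn_divLR // (leq_trans _ le_n).
  by have := leq_trans (ltn_ord x) le_n; rewrite k0 muln0.
rewrite (bigD1 (Ordinal ltx)) //= big1 => [|q neq_q].
  rewrite !mxE /= eqxx mul1r addr0 /cadj /= /dcliques_adj eq_sym.
  by rewrite [y %/ _ == _]eq_sym; case: eqVneq => [->|] //=; rewrite eqxx.
rewrite !mxE; suff /negbTE -> : x %/ k != q by rewrite mul0r.
by rewrite eq_sym.
Qed.

End DisjointCliques.

Theorem theorem2p13 (R : realType) (s t : nat) (ht : 2 <= t <= 5) (hs : 1 < s) :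
  is_rank_ramsey_number R s t ((s - 1) * (t - 1) + 1).
Proof.
case/andP: ht => t_gt1 t_le5.
have s1_gt0 : 0 < s - 1 by rewrite subn_gt0.
split=> [G | M propM].
  have [|lt_ws] := leqP s (clique_number G); [by left | right].
  rewrite leqNgt; apply/negP => lt_rt.
  have [col [col_lt col_adj]] := rank_clique_cover (leq_trans lt_rt t_le5).
  have := card_le_clique_cover col_lt col_adj; apply/negP.
  rewrite -ltnNge [ltnRHS]addn1 ltnS mulnC.
  by rewrite leq_mul // leq_subRL ?(ltnW hs) ?(ltnW t_gt1) // add1n.
(* Any M <= (s-1)(t-1) fails: M vertices fit into t-1 cliques of size at most s-1. *)
rewrite addn1 ltnNge; apply/negP => le_M.
have [] := propM (dcliques (s - 1) M); apply/negP; rewrite -ltnNge.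
  apply: leq_ltn_trans (clique_number_dcliques _ s1_gt0) _.
  by rewrite subn1 prednK // ltnW.
apply: leq_ltn_trans (rank_dcliques R (r := t - 1) _) _; first by rewrite mulnC.
by rewrite subn1 prednK // ltnW.
Qed.
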